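(* Let $\mu$ and $\nu$ be good non-defective measures on Cantor spaces $X$ and $Y$ respectively. Let $\mathfrak{M}=\mathfrak{M}_\mu\subset X$ be the defective set of $\mu$ and $\mathfrak{N}=\mathfrak{M}_\nu\subset Y$ the defective set of $\nu$. Then $\mu$ is homeomorphic to $\nu$ if and only if the following two conditions hold: (1) $S(\mu)=S(\nu)$; (2) there exists a homeomorphism $\widetilde{h}\colon \mathfrak{M}\to\mathfrak{N}$, where $\mathfrak{M}$ and $\mathfrak{N}$ are endowed with the induced (subspace) topologies.
   Context: A Cantor space is a non-empty zero-dimensional compact perfect metric space. A Borel measure on a Cantor space $X$ is full if every non-empty open set has positive measure. $M_\infty(X)$ is the set of all full non-atomic Borel measures $\mu$ on $X$ with $\mu(X)=\infty$. For $\mu\in M_\infty(X)$ the defective set is $\mathfrak{M}_\mu=\{x\in X:\mu(U)=\infty\text{ for every clopen }U\ni x\}$. A measure $\mu\in M_\infty(X)$ is non-defective if $\mu(\mathfrak{M}_\mu)=0$; the class of non-defective measures is $M^0_\infty(X)$. For $\mu\in M^0_\infty(X)$ the clopen values set is $S(\mu)=\{\mu(U): U\text{ clopen in }X,\ \mu(U)<\infty\}$. A measure $\mu\in M^0_\infty(X)$ is good if whenever $U,V$ are clopen subsets of $X$ with $\mu(U)<\mu(V)$, there is a clopen $W\subset V$ with $\mu(W)=\mu(U)$. Measures $\mu$ on $X$ and $\nu$ on $Y$ are homeomorphic if there is a homeomorphism $h\colon X\to Y$ with $h_*\mu=\nu$. *)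

(* Defs.v *)
From HB Require Import structures.
From mathcomp Require Import all_boot all_order all_algebra.
From mathcomp Require Import all_classical all_reals all_analysis.

Set Implicit Arguments.
Unset Strict Implicit.
Unset Printing Implicit Defensive.

Import Order.TTheory GRing.Theory Num.Theory.

Local Open Scope classical_set_scope.
Local Open Scope ring_scope.
Local Open Scope ereal_scope.

(* [measurableType] extends [pointedType], so a metric space has to carry a
   base point before measures on it can be considered. The base point has no
   role other than to make the space non-empty. *)
#[short(type="pmetricType")]
HB.structure Definition PointedMetric (K : numDomainType) :=
  {T of Pointed T & Metric K T}.

(* A Cantor space is a non-empty perfect compact zero-dimensional metric space.
   The predicate [zero_dimensional] inside [cantor_like] says that clopen sets
   separate points, which for a compact space is the same as having a base of
   clopen sets. *)
Definition cantor_metric_space (R : realType) (X : pmetricType R) :=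
  cantor_like X.

Notation borelType X := (g_sigma_algebraType (@open X)).

Section measures.
Context {R : realType} {X : pmetricType R}.
Variable mu : {measure set (borelType X) -> \bar R}.

Definition full_measure :=
  forall U : set X, open U -> U !=set0 -> 0 < mu U.

Definition atom (A : set (borelType X)) :=
  [/\ measurable A, 0 < mu A &
      forall B : set (borelType X), measurable B -> B `<=` A ->
        mu B < mu A -> mu B = 0].

Definition nonatomic := forall A : set (borelType X), ~ atom A.

(* membership in M_oo(X) *)
Definition full_nonatomic_infinite :=
  [/\ full_measure, nonatomic & mu [set: X] = +oo].

Definition defective_set : set X :=
  [set x | forall U : set X, clopen U -> U x -> mu U = +oo].

(* membership in M^0_oo(X); [defective_set] is closed, hence Borel *)
Definition nondefective :=
  full_nonatomic_infinite /\ mu defective_set = 0.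

Definition clopen_values : set (\bar R) :=
  [set mu U | U in [set U : set X | clopen U /\ mu U < +oo]].

Definition good_measure :=
  nondefective /\
  forall U V : set X, clopen U -> clopen V -> mu U < mu V ->
    exists W : set X, [/\ clopen W, W `<=` V & mu W = mu U].

End measures.

Definition homeomorphism (X Y : topologicalType) (f : X -> Y) :=
  continuous f /\
  exists g : Y -> X, [/\ cancel f g, cancel g f & continuous g].

Definition homeomorphic_measures (R : realType) (X Y : pmetricType R)
    (mu : {measure set (borelType X) -> \bar R})
    (nu : {measure set (borelType Y) -> \bar R}) :=
  exists h : X -> Y, homeomorphism h /\
    forall B : set (borelType Y), measurable B ->
      pushforward mu (h : borelType X -> borelType Y) B = nu B.

(* Main.v *)
(* For a good measure a clopen set V contains clopen sets of every admissible
   finite measure smaller than mu V. Given a homeomorphism t of the defective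
   sets, call clopen sets P and Q matched when they have the same measure and t
   carries the defective points of P onto those of Q. If P and Q are matched, a
   clopen splitting of P is copied to Q: a piece of finite measure has no
   defective points, so goodness supplies a copy of it and the rest is matched
   automatically; if both pieces have infinite measure, they meet the defective
   set by compactness, and any clopen set extending the t-image of their
   defective points will do. Back and forth along enumerations of the clopen
   sets then yields an isomorphism of clopen algebras preserving the measure,
   hence a homeomorphism. Equality on clopen sets implies equality on Borel sets,
   because the defective set is null and its complement is covered by countably
   many clopen sets of finite measure. *)
Require Import Defs.
From HB Require Import structures.
From mathcomp Require Import all_boot all_order all_algebra.
From mathcomp Require Import finmap.
From mathcomp Require Import all_classical all_reals all_analysis.

Set Implicit Arguments.
Unset Strict Implicit.
Unset Printing Implicit Defensive.

Import Order.TTheory GRing.Theory Num.Theory.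
Local Open Scope classical_set_scope.
Local Open Scope ring_scope.
Local Open Scope ereal_scope.

(** * Compactness arguments for clopen and closed sets *)

Lemma clopenD (T : topologicalType) (A B : set T) :
  clopen A -> clopen B -> clopen (A `\` B).
Proof. by move=> cA cB; rewrite setDE; apply: clopenI => //; exact: clopenC. Qed.

(** A finite subcover is merged into one set, one member at a time. Below, [P] is finiteness of
    measure or containment of a trace in an open set. *)
Lemma compact_clopen_cover (T : ptopologicalType) (K : set T) (P : set T -> Prop) :
  compact K -> P set0 -> (forall U V, P U -> P V -> P (U `|` V)) ->
  (forall x, K x -> exists U, [/\ clopen U, U x & P U]) ->
  exists U, [/\ clopen U, K `<=` U & P U].
Proof.
move=> cK P0 PU h.
have {h}/choice[F FP] x : exists U : set T, K x -> [/\ clopen U, U x & P U].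
  by have [Kx|nKx] := pselect (K x); [have [U] := h _ Kx; exists U|exists set0].
move: cK; rewrite compact_cover => /(_ _ K F)[x Kx||D DK KD].
- by have [[]] := FP _ Kx.
- by move=> x Kx; exists x => //; have [] := FP _ Kx.
suff [U [cU DU PUU]] : exists U, [/\ clopen U, cover [set` D] F `<=` U & P U].
  by exists U; split => //; exact: subset_trans DU.
rewrite /cover; have : {subset enum_fset D <= K} by move=> x /DK.
have -> : [set` D] = [set x | x \in enum_fset D] by [].
elim: (enum_fset D) => [|x s ih] sK.
  by exists set0; split => [|y [z]|//] //; exact: clopen0.
have [y ys|U [cU sU PUU]] := ih; first by apply: sK; rewrite inE ys orbT.
have [|cF Fx PF] := FP x; first by apply/set_mem/sK; rewrite mem_head.
exists (F x `|` U); split; [exact: clopenU| |exact: PU].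
move=> y [z /=]; rewrite inE => /orP[/eqP ->|zs] Fy; first by left.
by right; apply: sU; exists z.
Qed.

(** The sets [K n] form a base of a proper filter, and a cluster point of it lies in every [K n] by
    closedness. *)
Lemma compact_decreasing_inter (T : topologicalType) (K : nat -> set T) :
  compact [set: T] -> (forall n, closed (K n)) -> (forall n, K n !=set0) ->
  (forall n, K n.+1 `<=` K n) -> exists x, forall n, K n x.
Proof.
move=> cT clK K0 Kd.
have Kle m n : (m <= n)%N -> K n `<=` K m.
  elim: n => [|n ih]; first by rewrite leqn0 => /eqP ->.
  by rewrite leq_eqVlt ltnS => /orP[/eqP ->//|/ih]; exact: subset_trans (Kd n).
pose F := filter_from [set: nat] K.
have FF : ProperFilter F.
  apply: filter_from_proper => [|i _]; last exact: K0.
  apply: filter_from_filter; first by exists 0%N.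
  move=> i j _ _; exists (maxn i j) => // x Kx.
  by split; apply: Kle Kx; rewrite ?leq_maxl ?leq_maxr.
have [x [_ clx]] := cT F FF filterT.
exists x => n; apply: clK => B Bx.
by apply: clx => //; exists n.
Qed.

(** * Clopen sets of a Cantor space *)

Section clopen_base.
Context {R : realType} {X : pmetricType R}.
Hypothesis cX : cantor_metric_space X.

Lemma cantor_compact : compact [set: X]. Proof. by case: cX. Qed.

Lemma cantor_clopen_nbhs (x : X) (B : set X) :
  nbhs x B -> exists U, [/\ clopen U, U x & U `<=` B].
Proof.
case: cX => _ cpt haus zd.
by move/(zero_dimensional_cvg haus zd cpt) => -[U [Ux cU] UB]; exists U.
Qed.

Lemma cantor_clopen_inj (x y : X) :
  (forall U : set X, clopen U -> U x -> U y) -> x = y.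
Proof.
case: cX => _ _ _ zd h; apply: contrapT => /eqP /zd [U [cU Ux]].
by apply; exact: h.
Qed.

Lemma cantor_continuous (T : topologicalType) (f : T -> X) :
  (forall U : set X, clopen U -> open (f @^-1` U)) -> continuous f.
Proof.
move=> h x B /cantor_clopen_nbhs[U [cU Ux UB]].
rewrite nbhs_simpl /=; apply: (filterS (fun y => UB (f y))).
by apply: open_nbhs_nbhs; split => //; exact: h.
Qed.

Lemma clopen_seq : exists A : nat -> set X,
  (forall n, clopen (A n)) /\ forall U : set X, clopen U -> exists n, A n = U.
Proof.
have [f] := clopen_surj cantor_compact.
exists f; split => [n|U cU]; first exact: funS.
have [n _ <-] := @surj _ _ _ _ f U cU.
by exists n.
Qed.

End clopen_base.

(** * Measures of clopen sets and defective points *)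

Section good.
Context {R : realType} {X : pmetricType R}.
Hypothesis cX : cantor_metric_space X.
Variable mu : {measure set (borelType X) -> \bar R}.

Lemma clopen_measurable (U : set X) :
  clopen U -> measurable (U : set (borelType X)).
Proof. by case=> oU _; exact: sub_sigma_algebra. Qed.

Lemma clopen_measureID (U A : set X) : clopen U -> clopen A ->
  mu U = mu (U `&` A) + mu (U `\` A).
Proof.
move=> /clopen_measurable mU /clopen_measurable mA.
by rewrite addeC; exact: measureDI.
Qed.

(** If [U] has no defective point, each of its points has a clopen neighbourhood of finite measure,
    and finitely many of these cover [U]. *)
Lemma clopen_defective (U : set X) : clopen U ->
  (exists2 x, defective_set mu x & U x) <-> mu U = +oo.
Proof.
move=> cU; split=> [[x dx Ux]|Uoo]; first exact: dx.
apply: contrapT => nd.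
have [||||V [cV UV Vfin]] :=
    @compact_clopen_cover X U (fun U => clopen U /\ mu U < +oo).
- by rewrite -[U]setTI; apply: compact_closedI (cantor_compact cX) cU.2.
- by rewrite measure0; split => //; exact: clopen0.
- move=> A B [cA Afin] [cB Bfin]; split; first exact: clopenU.
  apply: le_lt_trans (lte_add_pinfty Afin Bfin).
  by apply: measureU2; exact: clopen_measurable.
- move=> x Ux; apply: contrapT => nx; apply: nd; exists x => // A cA Ax.
  by apply/eqP; rewrite eq_le leey /= leNgt; apply/negP => Afin; apply: nx; exists A.
case: Vfin => _; rewrite ltNge => /negP; apply.
by rewrite -Uoo; apply: le_measure; rewrite ?inE//; exact: clopen_measurable.
Qed.

Lemma clopen_null_empty (U : set X) : full_measure mu -> clopen U ->
  mu U = 0 -> U = set0.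
Proof.
move=> full [oU _] U0; apply/eqP; apply: contraPT isT => /set0P /(full _ oU).
by rewrite U0 ltxx.
Qed.

Lemma defective_closed : closed (defective_set mu).
Proof.
move=> x xd U cU Ux; have [|y [dy Uy]] := xd U; last exact: dy.
by apply: open_nbhs_nbhs; split=> //; case: cU.
Qed.

End good.

(** * Splitting matched pairs of clopen sets *)

Lemma ge0_fin_addeI {R : realType} (a b c : \bar R) :
  0 <= a -> a < +oo -> a + b = a + c -> b = c.
Proof.
move=> a0 afin /(congr1 (fun t => t - a)).
by rewrite ![a + _]addeC !addeK// ge0_fin_numE.
Qed.

Section matching.
Context {R : realType} {X Y : pmetricType R}.
Variables (mu : {measure set (borelType X) -> \bar R})
          (nu : {measure set (borelType Y) -> \bar R}) (r : X -> Y -> Prop).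

(** [r] stands for the graph of the homeomorphism of defective sets. With a relation instead of a
    map on subtypes, the two spaces are exchanged by reversing the arguments of [r]. *)
Definition matched (P : set X) (Q : set Y) :=
  [/\ clopen P, clopen Q, mu P = nu Q & forall x y, r x y -> (P x <-> Q y)].

Hypotheses (cX : cantor_metric_space X) (cY : cantor_metric_space Y).
Hypothesis good_nu : good_measure nu.
Hypothesis values_sub : clopen_values mu `<=` clopen_values nu.
Hypothesis r_def : forall x y, r x y -> defective_set mu x /\ defective_set nu y.
Hypothesis r_total : forall x, defective_set mu x -> exists y, r x y.
Hypothesis r_clopen : forall A : set X, clopen A ->
  exists2 C : set Y, clopen C & forall x y, r x y -> (A x <-> C y).

Lemma finite_undefective (A : set X) x y : clopen A -> mu A < +oo -> r x y -> ~ A x.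
Proof.
by move=> cA Afin /r_def[dx _] Ax; move: Afin; rewrite (dx _ cA Ax) ltxx.
Qed.

(** The finite piece and its copy contain no defective points, so only the measures have to be
    arranged. *)
Lemma matched_split_finite P Q A : matched P Q -> clopen A -> mu (P `&` A) < +oo ->
  exists B, [/\ clopen B, B `<=` Q, matched (P `&` A) (Q `&` B)
            & matched (P `\` A) (Q `\` B)].
Proof.
move=> [cP cQ PQ rPQ] cA PAfin.
have cPA : clopen (P `&` A) by exact: clopenI.
have cPDA : clopen (P `\` A) by exact: clopenD.
have mPA := clopen_measureID mu cP cA.
suff [B [cB BQ Bval Dval]] : exists B : set Y, [/\ clopen B, B `<=` Q,
    nu B = mu (P `&` A) & nu (Q `\` B) = mu (P `\` A)].
  have QB : Q `&` B = B by exact: setIidr.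
  have nr x y : r x y -> ~ A x \/ ~ P x.
    move=> rxy; have := finite_undefective cPA PAfin rxy.
    by move/not_andP => []; tauto.
  have nB x y : r x y -> ~ B y.
    by move=> /r_def[_ dy] By; move: PAfin; rewrite -Bval (dy _ cB By) ltxx.
  exists B; split => //.
  - rewrite QB; split=> // x y rxy; have := nr _ _ rxy; have := nB _ _ rxy.
    by rewrite /setI /=; tauto.
  - split=> // [|x y rxy]; first exact: clopenD.
    have := nr _ _ rxy; have := nB _ _ rxy; have := rPQ _ _ rxy.
    by rewrite /setD /=; tauto.
(* Goodness needs a strict inequality. In the case of equality all of [Q] serves as the copy, and
   both remainders are null. *)
have [PAltP|PAgeP] := ltP (mu (P `&` A)) (mu P).
  have [|U [cU Ufin] UPA] := values_sub (t := mu (P `&` A)).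
    by exists (P `&` A).
  have [|W [cW WQ Wval]] := good_nu.2 U Q cU cQ; first by rewrite UPA -PQ.
  exists W; split => //; first by rewrite Wval.
  have := clopen_measureID nu cQ cW.
  have -> : Q `&` W = W by exact: setIidr.
  (* The removed piece has finite measure, so it cancels even if the remainders are infinite. *)
  rewrite Wval UPA -PQ mPA => /esym; apply: ge0_fin_addeI => //.
have PAP : mu (P `&` A) = mu P.
  apply/eqP; rewrite eq_le PAgeP andbT; apply: le_measure; rewrite ?inE.
  - exact: clopen_measurable.
  - exact: clopen_measurable.
  - exact: subIsetl.
exists Q; split => //; rewrite ?setDv ?measure0; first by rewrite -PQ.
rewrite (_ : mu _ = 0)//.
move: mPA; rewrite -PAP -[X in X = _]adde0 => /ge0_fin_addeI -> //.
Qed.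

Lemma matched_split P Q A : matched P Q -> clopen A ->
  exists B, [/\ clopen B, B `<=` Q, matched (P `&` A) (Q `&` B)
            & matched (P `\` A) (Q `\` B)].
Proof.
move=> mPQ cA.
have [PAfin|PAoo] := ltP (mu (P `&` A)) (+oo); first exact: matched_split_finite.
(* If the part outside [A] is finite, it is that part which is copied, and the witness is the rest
   of [Q]. *)
have [PDfin|PDoo] := ltP (mu (P `&` ~` A)) (+oo).
  have [B [cB BQ m1 m2]] := matched_split_finite mPQ (clopenC setT cA) PDfin.
  have cQ : clopen Q by case: mPQ.
  exists (Q `\` B); split => //; first exact: clopenD.
  - move: m2; rewrite !setDE setCK.
    by rewrite setIA setIid.
  - move: m1; rewrite !setDE setCI setCK.
    by rewrite setIUr setICr set0U.
move: mPQ => [cP cQ PQ rPQ].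
have [C cC rAC] := r_clopen cA.
(* A set [D] of infinite measure has a defective point; its partner under [r] lies in [E] and forces
   [nu E] to be infinite. *)
have oo_match (D : set X) (E : set Y) : clopen D -> clopen E -> +oo <= mu D ->
    (forall x y, r x y -> (D x <-> E y)) -> matched D E.
  move=> cD cE; rewrite leye_eq => /eqP Doo rDE; split => //; rewrite Doo; apply/esym.
  have [x dx Dx] := (clopen_defective cX mu cD).2 Doo.
  have [y rxy] := r_total dx.
  by apply/(clopen_defective cY nu cE); exists y; [case: (r_def rxy)|apply/(rDE x)].
have cQC : clopen (Q `&` C) by exact: clopenI.
exists (Q `&` C); split => //.
- rewrite setIA setIid; apply: oo_match => //; first exact: clopenI.
  by move=> x y rxy; rewrite /setI /= (rPQ x y) // (rAC x y).
- apply: oo_match; [exact: clopenD|exact: clopenD|by rewrite setDE|].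
  move=> x y rxy; rewrite /setD /setI /= (rPQ x y) // (rAC x y)//.
  by tauto.
Qed.

End matching.

Lemma matched_swap {R : realType} {X Y : pmetricType R}
    (mu : {measure set (borelType X) -> \bar R})
    (nu : {measure set (borelType Y) -> \bar R}) (r : X -> Y -> Prop) P Q :
  matched mu nu r P Q <-> matched nu mu (fun y x => r x y) Q P.
Proof.
by split=> -[cP cQ PQ rPQ]; split => // x y rxy; split=> /(rPQ _ _ rxy).
Qed.

(** * Coherent lists of pairs and their extension *)

Section coherent_lists.
Context {X Y : topologicalType}.
Implicit Types (m : set X -> set Y -> Prop) (l : seq (set X * set Y)).

(* The pairs in [l] cut [P] and [Q] into cells indexed by sign patterns;
   [coherent] says that cells with the same pattern are related by [m]. *)
Fixpoint coherent m (P : set X) (Q : set Y) l : Prop :=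
  if l is p :: l' then
    coherent m (P `&` p.1) (Q `&` p.2) l' /\ coherent m (P `\` p.1) (Q `\` p.2) l'
  else m P Q.

(** All cells on the right lie in [Q], so only the trace of [B] on [Q] counts. This permits gluing
    sets found in separate cells. *)
Lemma coherent_rcons_congr m P Q l A B B' : (forall y, Q y -> (B y <-> B' y)) ->
  coherent m P Q (rcons l (A, B)) -> coherent m P Q (rcons l (A, B')).
Proof.
elim: l P Q => [|p l ih] P Q BB' /=.
  suff [-> ->] : Q `&` B = Q `&` B' /\ Q `\` B = Q `\` B' by [].
  by split; apply/seteqP; split => y [Qy]; have [] := BB' y Qy; split; auto.
by move=> [coh1 coh2]; split;
  [apply: ih coh1 => y [Qy _]|apply: ih coh2 => y [Qy _]]; exact: BB'.
Qed.

Definition splits m := forall P Q A, m P Q -> clopen A ->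
  exists B, [/\ clopen B, B `<=` Q, m (P `&` A) (Q `&` B) & m (P `\` A) (Q `\` B)].

(** The head of the list cuts [Q] in two; induction gives [B1] inside one part and [B2] inside the
    other, and on each part the union agrees with the set found there. *)
Lemma coherent_extend m P Q l A : splits m -> coherent m P Q l -> clopen A ->
  exists B, [/\ clopen B, B `<=` Q & coherent m P Q (rcons l (A, B))].
Proof.
move=> spl; elim: l P Q => [|p l ih] P Q /= coh cA.
  by have [B [cB BQ m1 m2]] := spl _ _ _ coh cA; exists B.
have [B1 [cB1 B1Q coh1]] := ih _ _ coh.1 cA.
have [B2 [cB2 B2Q coh2]] := ih _ _ coh.2 cA.
exists (B1 `|` B2); split; first exact: clopenU.
- by move=> y [/B1Q[]|/B2Q[]].
split.
- apply: coherent_rcons_congr coh1 => y [_ py]; split=> [?|]; first by left.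
  by move=> [//|/B2Q[]].
- apply: coherent_rcons_congr coh2 => y [_ py]; split=> [?|]; first by right.
  by move=> [/B1Q[]|//].
Qed.

(** [x] is followed into the cell with its own sign pattern; the partner cell is non-empty, and its
    points have the same signs. *)
Lemma coherent_point m P Q l x :
  (forall P Q, m P Q -> P !=set0 -> Q !=set0) -> coherent m P Q l -> P x ->
  exists y, Q y /\ forall p, p \in l -> (p.1 x <-> p.2 y).
Proof.
move=> m0; elim: l P Q => [|p l ih] P Q /=.
  by move=> /m0 h Px; have [|y Qy] := h; [exists x|exists y].
move=> [coh1 coh2] Px; have [px|npx] := pselect (p.1 x).
- have [//|y [[Qy py] yl]] := ih _ _ coh1.
  by exists y; split => // q; rewrite inE => /orP[/eqP ->|/yl].
- have [//|y [[Qy py] yl]] := ih _ _ coh2.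
  by exists y; split => // q; rewrite inE => /orP[/eqP ->|/yl].
Qed.

End coherent_lists.

Definition swap_pairs {X Y : Type} (l : seq (set X * set Y)) : seq (set Y * set X) :=
  [seq (p.2, p.1) | p <- l].

Lemma mem_swap_pairs {X Y : Type} (l : seq (set X * set Y)) U V :
  ((V, U) \in swap_pairs l) = ((U, V) \in l).
Proof.
have inj : injective (fun p : set X * set Y => (p.2, p.1)).
  by move=> [a b] [c d] [-> ->].
by rewrite -[(V, U)]/((fun p : set X * set Y => (p.2, p.1)) (U, V)) mem_map.
Qed.

Lemma coherent_swap {X Y : topologicalType} (m : set X -> set Y -> Prop) P Q l :
  coherent m P Q l <-> coherent (fun Q P => m P Q) Q P (swap_pairs l).
Proof. by elim: l P Q => [|p l ih] P Q //=; rewrite -!ih. Qed.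

(** * The back-and-forth construction *)

Section back_and_forth.
Context {R : realType} {X Y : pmetricType R}.
Hypotheses (cX : cantor_metric_space X) (cY : cantor_metric_space Y).
Variable m : set X -> set Y -> Prop.
Hypotheses (mT : m setT setT) (m_splits : splits m).
Hypothesis m_splits_swap : splits (fun Q P => m P Q).

Definition clopen_coherent (l : seq (set X * set Y)) :=
  coherent m setT setT l /\ forall U V, (U, V) \in l -> clopen U /\ clopen V.

(** A forth step finds a partner for [A]; a back step, made on the swapped list, then finds one for
    [C]. *)
Lemma clopen_coherent_extend l A C : clopen_coherent l -> clopen A -> clopen C ->
  exists l', [/\ clopen_coherent l', {subset l <= l'},
    exists V, (A, V) \in l' & exists U, (U, C) \in l'].
Proof.
move=> [coh cl] cA cC.
have [B [cB _ coh1]] := coherent_extend m_splits coh cA.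
have [D [cD _]] :=
  coherent_extend m_splits_swap (iffLR (coherent_swap _ _ _ _) coh1) cC.
rewrite -[(C, D)]/((fun p : set X * set Y => (p.2, p.1)) (D, C)) -map_rcons.
move=> /(iffRL (coherent_swap _ _ _ _)) coh2.
exists (rcons (rcons l (A, B)) (D, C)); split.
- split=> // U V; rewrite !(mem_rcons, inE).
  by case/orP=> [/eqP[-> ->]//|/orP[/eqP[-> ->]//|/cl]].
- by move=> p pl; rewrite !(mem_rcons, inE) pl !orbT.
- by exists B; rewrite !(mem_rcons, inE) eqxx orbT.
- by exists D; rewrite !(mem_rcons, inE) eqxx.
Qed.

Lemma back_and_forth_lists : exists L : nat -> seq (set X * set Y),
  [/\ forall n, clopen_coherent (L n), forall n, {subset L n <= L n.+1},
      forall U, clopen U -> exists n V, (U, V) \in L n &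
      forall V, clopen V -> exists n U, (U, V) \in L n].
Proof.
have [A [cA surA]] := clopen_seq cX; have [C [cC surC]] := clopen_seq cY.
(* The stage index is passed along with the list, so that one choice function serves all stages. The
   empty list is a dummy value for inputs that are not coherent. *)
have /choice[f fP] (nl : nat * seq (set X * set Y)) : exists l',
    clopen_coherent nl.2 -> [/\ clopen_coherent l', {subset nl.2 <= l'},
    exists V, (A nl.1, V) \in l' & exists U, (U, C nl.1) \in l'].
  have [coh|ncoh] := pselect (clopen_coherent nl.2); last by exists [::].
  by have [l' lP] := clopen_coherent_extend coh (cA nl.1) (cC nl.1); exists l'.
pose fix L n := if n is n'.+1 then f (n', L n') else [::].
have cohL n : clopen_coherent (L n).
  by elim: n => [//|n /(fP (n, _))[]].
exists L; split => // [n|U /surA[n <-]|V /surC[n <-]].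
- by have [] := fP (n, L n) (cohL n).
- by have [_ _ [V ?] _] := fP (n, L n) (cohL n); exists n.+1, V.
- by have [_ _ _ [U ?]] := fP (n, L n) (cohL n); exists n.+1, U.
Qed.

End back_and_forth.

(** * The point map defined by an increasing sequence of lists *)

Section limit_map.
Context {R : realType} {X Y : pmetricType R}.
Hypothesis cY : cantor_metric_space Y.

(** For fixed [x], the points of [Y] with the same signs as [x] along [L n] form a non-empty closed
    set that shrinks as [n] grows; compactness gives a point common to all of them. *)
Lemma limit_map (L : nat -> seq (set X * set Y)) :
  (forall n U V, (U, V) \in L n -> clopen V) -> (forall n, {subset L n <= L n.+1}) ->
  (forall n x, exists y, forall p, p \in L n -> (p.1 x <-> p.2 y)) ->
  exists h : X -> Y, forall n U V, (U, V) \in L n -> forall x, U x <-> V (h x).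
Proof.
move=> cL mono ex.
suff /choice[h hP] : forall x, exists y, forall n p, p \in L n -> (p.1 x <-> p.2 y).
  by exists h => n U V UV x; exact: (hP x n (U, V)).
move=> x; apply: (@compact_decreasing_inter _
  (fun n => [set y | forall p, p \in L n -> (p.1 x <-> p.2 y)])).
- exact: cantor_compact.
- move=> n.
  have -> : [set y | forall p, p \in L n -> (p.1 x <-> p.2 y)] =
      \bigcap_(p in [set p | p \in L n]) (if `[< p.1 x >] then p.2 else ~` p.2).
    apply/seteqP; split => y /= h p pl; have := h p pl.
      by case: asboolP; rewrite /setC /=; tauto.
    by case: asboolP; rewrite /setC /=; tauto.
  apply: closed_bigI => -[U V] /cL /= [oV clV].
  by case: ifP => // _; exact: open_closedC.
- by move=> n; have [y yP] := ex n x; exists y.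
- by move=> n y yP p pl; apply: yP; exact: mono.
Qed.

End limit_map.

(** * Equality of measures on clopen and on Borel sets *)

Lemma coherent_matched_measure {R : realType} {X Y : pmetricType R}
    (mu : {measure set (borelType X) -> \bar R})
    (nu : {measure set (borelType Y) -> \bar R}) (r : X -> Y -> Prop) P Q l :
  coherent (matched mu nu r) P Q l -> clopen P -> clopen Q ->
  (forall U V, (U, V) \in l -> clopen U /\ clopen V) ->
  mu P = nu Q /\
  forall U V, (U, V) \in l -> mu (P `&` U) = nu (Q `&` V).
Proof.
elim: l P Q => [|[A B] l ih] P Q /=; first by move=> [].
move=> [coh1 coh2] cP cQ cl.
have [cA cB] : clopen A /\ clopen B by apply: cl; rewrite mem_head.
have cl' U V : (U, V) \in l -> clopen U /\ clopen V.
  by move=> UV; apply: cl; rewrite inE UV orbT.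
have [m1 l1] := ih _ _ coh1 (clopenI cP cA) (clopenI cQ cB) cl'.
have [m2 l2] := ih _ _ coh2 (clopenD cP cA) (clopenD cQ cB) cl'.
split.
  by rewrite (clopen_measureID mu cP cA) (clopen_measureID nu cQ cB) m1 m2.
move=> U V; rewrite inE => /orP[/eqP[-> ->]//|UV]; have [cU cV] := cl' _ _ UV.
(* Cutting along [A] and [B] puts both sides under the two induction hypotheses, and additivity
   joins the results. *)
rewrite (clopen_measureID mu (clopenI cP cU) cA).
rewrite (clopen_measureID nu (clopenI cQ cV) cB).
rewrite !setDE [P `&` U `&` A]setIAC [Q `&` V `&` B]setIAC.
by rewrite [P `&` U `&` _]setIAC [Q `&` V `&` _]setIAC -!setDE (l1 _ _ UV) (l2 _ _ UV).
Qed.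

Section borel_uniqueness.
Context {R : realType} {Y : pmetricType R}.
Hypothesis cY : cantor_metric_space Y.

(** Clopen sets of finite measure contain no defective points and so may fail to cover the space.
    Adding the null set [N] to the generator and to the cover makes uniqueness of measures on an
    intersection-stable generator applicable. *)
Lemma clopen_measure_unique (m1 m2 : {measure set (borelType Y) -> \bar R}) :
  (forall U : set Y, clopen U -> m1 U = m2 U) ->
  m1 (defective_set m2) = 0 -> m2 (defective_set m2) = 0 ->
  forall B : set (borelType Y), measurable B -> m1 B = m2 B.
Proof.
move=> m12 N1 N2; set N : set Y := defective_set m2.
have mN : measurable (N : set (borelType Y)).
  rewrite -[X in measurable X]setCK; apply: measurableC; apply: sub_sigma_algebra.
  by apply: closed_openC; exact: defective_closed.
have [A [cA surA]] := clopen_seq cY.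
pose G : set (set (borelType Y)) :=
  [set C | clopen (C : set Y) \/ exists2 D : set Y, clopen D & C = D `&` N].
(* Index 0 is [N]; clopen sets of infinite measure are replaced by the empty set. *)
pose g (n : nat) : set (borelType Y) :=
  if n is k.+1 then (if m2 (A k) < +oo then A k else set0) else N.
have G0 : G set0 by left; exact: clopen0.
have Gg n : G (g n).
  case: n => [|n] /=; first by right; exists setT; [exact: clopenT|rewrite setTI].
  by case: ifP => // _; left.
apply: (@measure_unique _ _ _ G g) => //.
- apply/seteqP; split.
    apply: smallest_sub; first exact: smallest_sigma_algebra.
    move=> U oU.
    (* The countably many clopen sets form a base, so [U] is the union of those it contains. *)
    have -> : U = \bigcup_n (if `[< A n `<=` U >] then A n else set0).
      apply/seteqP; split => [x Ux|x [n _]]; last by case: asboolP => // AU /AU.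
      have [|V [/surA[n AnV] Vx VU]] := @cantor_clopen_nbhs _ _ cY x U.
        exact: open_nbhs_nbhs.
      by exists n => //; rewrite AnV; case: asboolP.
    apply: sigma_algebra_bigcup => n; apply: sub_sigma_algebra.
    by case: ifP => // _; left.
  apply: smallest_sub; first exact: sigma_algebra_measurable.
  move=> C [/clopen_measurable//|[D cD ->]].
  by apply: measurableI => //; exact: clopen_measurable.
- move=> B C [cB|[D cD ->]] [cC|[E cE ->]].
  + by left; exact: clopenI.
  + by right; exists (B `&` E); [exact: clopenI|rewrite setIA].
  + by right; exists (D `&` C); [exact: clopenI|rewrite setIAC].
  + by right; exists (D `&` E); [exact: clopenI|rewrite setIACA setIid].
- apply/seteqP; split => // x _; have [Nx|] := pselect (N x); first by exists 0%N.
  move=> /existsNP[U /not_implyP[/surA[n AU] /not_implyP[Ux /eqP Uoo]]].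
  by exists n.+1 => //=; rewrite AU ltey Uoo.
- move=> C [/m12//|[D /clopen_measurable mD ->]].
  have null (m : {measure set (borelType Y) -> \bar R}) : m N = 0 -> m (D `&` N) = 0.
    move=> mN0; apply: subset_measure0 mN0 => //; exact: measurableI.
  by rewrite !null.
- move=> [|n] /=; first by rewrite N1.
  by case: ifP => [|_]; rewrite ?measure0// m12.
Qed.

End borel_uniqueness.

(** * Transport of clopen values and defective points *)

Section clopen_preserving.
Context {R : realType} {X Y : pmetricType R}.
Variables (mu : {measure set (borelType X) -> \bar R})
          (nu : {measure set (borelType Y) -> \bar R}) (h : X -> Y).
Hypothesis h_cont : continuous h.
Hypothesis h_clopen : forall V : set Y, clopen V -> mu (h @^-1` V) = nu V.

Lemma clopen_preserving_defective x : defective_set mu x -> defective_set nu (h x).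
Proof.
move=> dx V cV Vhx; rewrite -h_clopen//.
by apply: dx => //; exact: preimage_clopen.
Qed.

Lemma clopen_preserving_values : clopen_values nu `<=` clopen_values mu.
Proof.
move=> _ [V [cV Vfin] <-]; exists (h @^-1` V); last exact: h_clopen.
by split; [exact: preimage_clopen|rewrite h_clopen].
Qed.

Lemma clopen_preserving_inverse (g : Y -> X) : cancel h g -> continuous g ->
  forall U : set X, clopen U -> nu (g @^-1` U) = mu U.
Proof.
move=> hK cg U cU; rewrite -h_clopen; last exact: preimage_clopen.
by rewrite -comp_preimage (_ : g \o h = id)//; apply/funext => x /=; rewrite hK.
Qed.

Definition defective_map (x : defective_set mu) : defective_set nu :=
  exist _ (h (set_val x)) (mem_set (clopen_preserving_defective (set_valP x))).

Lemma defective_map_continuous : continuous defective_map.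
Proof.
apply: (@continuous_comp_initial _ _ _ (@set_val _ (defective_set nu))).
move=> x; apply: (@continuous_comp _ _ _ set_val h); last exact: h_cont.
exact: initial_continuous.
Qed.

End clopen_preserving.

(** * Extending relatively clopen sets *)

Section relative_clopen.
Context {R : realType} {X Y : pmetricType R}.
Hypothesis cY : cantor_metric_space Y.

(** The preimage of [A] is compact in [Y], being what the open set [W'] leaves of [N], so it is
    covered by a clopen set whose trace on [N] stays in [W]. This is how continuity between the
    defective sets yields [r_clopen]. *)
Lemma relative_clopen (N : set Y) (f : N -> X) (A : set X) :
  closed N -> continuous f -> clopen A ->
  exists2 C : set Y, clopen C & forall e : N, C (set_val e) <-> A (f e).
Proof.
move=> clN cf [oA clA].
have [W oW WA] : open (f @^-1` A) by move/continuousP : cf; exact.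
have [W' oW' WA'] : open (f @^-1` (~` A)).
  by move/continuousP : cf; apply; exact: closed_openC.
have cK : compact (N `\` W').
  rewrite setDE -[N]setTI -setIA; apply: compact_closedI (cantor_compact cY) _.
  by apply: closedI => //; exact: open_closedC.
have NW (e : N) : W (set_val e) <-> A (f e).
  by rewrite -[A (f e)]/((f @^-1` A) e) -WA.
have NW' (e : N) : W' (set_val e) <-> ~ A (f e).
  by rewrite -[~ A (f e)]/((f @^-1` (~` A)) e) -WA'.
have [|U V UW VW|y [Ny nW'y]|U [cU KU UW]] :=
    @compact_clopen_cover Y _ (fun U => U `&` N `<=` W) cK.
- by rewrite set0I.
- by rewrite setIUl => y [/UW|/VW].
- have Wy : W y.
    pose e : N := exist _ y (mem_set Ny).
    apply: contrapT => nWy; apply: nW'y.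
    by apply/(NW' e) => /NW.
  have [|U [cU Uy UW]] := @cantor_clopen_nbhs _ _ cY y W.
    exact: open_nbhs_nbhs.
  by exists U; split => // z [/UW].
exists U => // e; split=> [Ue|Afe].
  by apply/NW/UW; split => //; exact: set_valP.
by apply: KU; split; [exact: set_valP|move/NW'].
Qed.

End relative_clopen.

(** * The two implications *)

Lemma homeomorphic_necessary (R : realType) (X Y : pmetricType R)
    (mu : {measure set (borelType X) -> \bar R})
    (nu : {measure set (borelType Y) -> \bar R}) :
  homeomorphic_measures mu nu ->
  clopen_values mu = clopen_values nu /\
  exists h : defective_set mu -> defective_set nu, homeomorphism h.
Proof.
move=> [h [[ch [g [hK gK cg]]] hmu]].
have hcl (V : set Y) : clopen V -> mu (h @^-1` V) = nu V.
  by move=> /clopen_measurable; exact: hmu.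
(* The inverse preserves clopen measures too, so every fact about [h] also holds with the spaces
   exchanged. *)
have gcl := clopen_preserving_inverse hcl hK cg.
split.
  by apply/seteqP; split; [exact: clopen_preserving_values cg gcl|
                           exact: clopen_preserving_values ch hcl].
exists (defective_map ch hcl); split; first exact: defective_map_continuous.
exists (defective_map cg gcl); split; last exact: defective_map_continuous.
- by move=> x; apply: val_inj; rewrite /= hK.
- by move=> y; apply: val_inj; rewrite /= gK.
Qed.

Lemma homeomorphic_sufficient (R : realType) (X Y : pmetricType R)
    (cX : cantor_metric_space X) (cY : cantor_metric_space Y)
    (mu : {measure set (borelType X) -> \bar R})
    (nu : {measure set (borelType Y) -> \bar R})
    (good_mu : good_measure mu) (good_nu : good_measure nu) :
  clopen_values mu = clopen_values nu ->
  (exists h : defective_set mu -> defective_set nu, homeomorphism h) ->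
  homeomorphic_measures mu nu.
Proof.
move=> values [t [ct [s [tK sK cs]]]].
have [[[full_mu _ muT] mu0] _] := good_mu.
have [[[full_nu _ nuT] nu0] _] := good_nu.
pose r x y := exists2 d : defective_set mu, x = set_val d & y = set_val (t d).
have r_def x y : r x y -> defective_set mu x /\ defective_set nu y.
  by move=> [d -> ->]; split; exact: set_valP.
have mT : matched mu nu r setT setT.
  by split; [exact: clopenT|exact: clopenT|rewrite muT|].
have split_XY : splits (matched mu nu r).
  move=> P Q A mPQ cA.
  apply: (@matched_split _ _ _ mu nu r cX cY good_nu _ r_def _ _ _ _ _ mPQ cA).
  - by rewrite values.
  - move=> x dx; pose e : defective_set mu := exist _ x (mem_set dx).
    by exists (set_val (t e)); exists e.
  - move=> U cU.
    (* Since [s] undoes [t], the preimage of [U] under [s] is the [t]-image of the defective points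
       in [U]. *)
    have cf : continuous (set_val \o s).
      by move=> y; apply: continuous_comp; [exact: cs|exact: initial_continuous].
    have [C cC CU] :=
      relative_clopen cY (@defective_closed _ _ nu) cf cU.
    exists C => // x y [d -> ->].
    by split=> [Ud|/CU/=]; [apply/CU => /=|]; rewrite tK.
have split_YX : splits (fun Q P => matched mu nu r P Q).
  move=> Q P A /matched_swap mQP cA.
  have [||y dy|U cU|B [cB BP m1 m2]] :=
    matched_split cY cX good_mu _ _ _ _ mQP cA.
  - by rewrite values.
  - by move=> y x /r_def[].
  - pose e : defective_set nu := exist _ y (mem_set dy).
    by exists (set_val (s e)); exists (s e) => //; rewrite sK.
  - have cf : continuous (set_val \o t).
      by move=> x; apply: continuous_comp; [exact: ct|exact: initial_continuous].
    have [C cC CU] :=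
      relative_clopen cX (@defective_closed _ _ mu) cf cU.
    by exists C => // y x [d -> ->]; split=> [Ud|/CU//]; apply/CU.
  - by exists B; split => //; apply/matched_swap.
have [L [cohL monoL surX surY]] :=
  back_and_forth_lists cX cY mT split_XY split_YX.
have clL n U V : (U, V) \in L n -> clopen U /\ clopen V by exact: (cohL n).2.
have measL n U V : (U, V) \in L n -> mu U = nu V.
  move=> UV.
  have := coherent_matched_measure (cohL n).1 clopenT clopenT (cohL n).2.
  by move=> [_ /(_ _ _ UV)]; rewrite !setTI.
(* By fullness a clopen set is empty exactly when it is null, so equal measures preserve
   emptiness. *)
have nonempty_XY P Q : matched mu nu r P Q -> P !=set0 <-> Q !=set0.
  move=> [cP cQ PQ _]; split=> /set0P /eqP n0; apply/set0P/eqP => e0; apply: n0.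
    by apply: (clopen_null_empty full_mu) => //; rewrite PQ e0 measure0.
  by apply: (clopen_null_empty full_nu) => //; rewrite -PQ e0 measure0.
have [|//|n x|h hL] := @limit_map _ X Y cY L.
- by move=> n U V /clL[].
- have [||y [_ yL]] := @coherent_point _ _ _ _ _ _ x _ (cohL n).1 => //.
    by move=> P Q /nonempty_XY[].
  by exists y.
have [|n|n y|g gL] := @limit_map _ Y X cX (fun n => swap_pairs (L n)).
- by move=> n V U; rewrite mem_swap_pairs => /clL[].
- by move=> [V U]; rewrite !mem_swap_pairs; exact: monoL.
- have coh' := iffLR (coherent_swap _ _ _ _) (cohL n).1.
  have [||x [_ xL]] := @coherent_point _ _ _ _ _ _ y _ coh' => //.
    by move=> P Q /nonempty_XY[].
  by exists x.
have gL' n U V : (U, V) \in L n -> forall y, V y <-> U (g y).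
  by move=> UV; apply: (gL n); rewrite mem_swap_pairs.
(* Every clopen set occurs in some pair, and [h] and [g] respect all pairs; hence [g (h x)] lies in
   every clopen set around [x]. *)
have hK : cancel h g.
  move=> x; apply/esym; apply: (cantor_clopen_inj cX) => U /surX[n [V UV]] Ux.
  by apply/(gL' _ _ _ UV)/(hL _ _ _ UV).
have gK : cancel g h.
  move=> y; apply/esym; apply: (cantor_clopen_inj cY) => V /surY[n [U UV]] Vy.
  by apply/(hL _ _ _ UV)/(gL' _ _ _ UV).
have preim_h n U V : (U, V) \in L n -> h @^-1` V = U.
  by move=> UV; apply/seteqP; split => x /(hL _ _ _ UV).
have ch : continuous h.
  apply: (cantor_continuous cY) => V /surY[n [U UV]].
  by rewrite (preim_h _ _ _ UV); case: (clL _ _ _ UV) => -[].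
have cg : continuous g.
  apply: (cantor_continuous cX) => U /surX[n [V UV]].
  have -> : g @^-1` U = V by apply/seteqP; split => y /(gL' _ _ _ UV).
  by case: (clL _ _ _ UV) => _ [].
have hcl (V : set Y) : clopen V -> mu (h @^-1` V) = nu V.
  by move=> /surY[n [U UV]]; rewrite (preim_h _ _ _ UV); exact: measL UV.
have gcl := clopen_preserving_inverse hcl hK cg.
exists h; split; first by split => //; exists g.
have mh : measurable_fun setT (h : borelType X -> borelType Y).
  apply: (@measurability _ _ (borelType X) (borelType Y) setT h (@open Y)) => //.
  move=> _ [V oV <-]; rewrite setTI.
  by apply: sub_sigma_algebra; move/continuousP : ch; exact.
pose hmu : {measure set (borelType Y) -> \bar R} :=
  measure_function_pushforward__canonical__measure_function_Measure mu mh.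
apply: (@clopen_measure_unique _ _ cY hmu nu) => //.
(* [h] and [g] both preserve defective points, so the preimage of the defective set of [nu] is that
   of [mu], which is null. *)
rewrite -[LHS]/(mu (h @^-1` defective_set nu)) -[RHS]mu0; congr (mu _).
apply/seteqP; split => x /=.
  by move=> /(clopen_preserving_defective cg gcl); rewrite hK.
exact: clopen_preserving_defective ch hcl _.
Qed.

(* In condition (2) the sets coerce to types ([set_type]), which carry the
   subspace topology. *)
Theorem theorem2p13 (R : realType) (X Y : pmetricType R)
    (cX : cantor_metric_space X) (cY : cantor_metric_space Y)
    (mu : {measure set (borelType X) -> \bar R})
    (nu : {measure set (borelType Y) -> \bar R})
    (good_mu : good_measure mu) (good_nu : good_measure nu) :
  homeomorphic_measures mu nu <->
  (clopen_values mu = clopen_values nu /\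
   exists h : defective_set mu -> defective_set nu, homeomorphism h).
Proof.
split; first exact: homeomorphic_necessary.
by move=> [values hom]; exact: homeomorphic_sufficient.
Qed.
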